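(* The spectrum of an orbigraph does not distinguish good orbigraphs from bad orbigraphs: there exist a good connected orbigraph and a bad connected orbigraph whose adjacency matrices have the same multiset of eigenvalues.
   Context: A $k$-orbigraph is a finite weighted directed graph $\Omega$ (loops allowed) on vertices $v_1,\dots,v_n$ whose adjacency matrix $A$ ($A_{ij}$ = weight of the directed edge $(v_i,v_j)$, $0$ if absent) satisfies: $A_{ij}\in\mathbb{Z}_{\ge 0}$; $\sum_j A_{ij}=k$ for every $i$; and $A_{ij}>0$ iff $A_{ji}>0$. It is connected if its underlying graph is connected. An undirected edge $\{u,v\}$ of weight $w$ is identified with the pair of directed edges $(u,v)$, $(v,u)$ of weight $w$; a simple $k$-regular graph is regarded as a weighted directed graph with all weights $1$. For a weighted graph $\Gamma$ with weight function $w$, a partition $\mathcal{P}=\{V_1,\dots,V_m\}$ of its vertices is equitable if for all $i,j$ the quantity $\sum_{v\in V_j} w(u,v)$ is the same for all $u\in V_i$; the quotient $\Gamma/\mathcal{P}$ is the weighted directed graph with adjacency matrix entries $\sum_{v\in V_j} w(u,v)$, $u\in V_i$. A $k$-orbigraph is good if it is (up to isomorphism) $\Gamma/\mathcal{P}$ for some finite $k$-regular graph $\Gamma$ and equitable partition $\mathcal{P}$; otherwise it is bad. *)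

(* Defs.v *)
From HB Require Import structures.
From mathcomp Require Import all_boot all_order all_algebra all_field.

Set Implicit Arguments.
Unset Strict Implicit.
Unset Printing Implicit Defensive.

Import GRing.Theory.

(* A weighted directed graph on a vertex type V is its weight function
   w : V -> V -> nat, weight 0 meaning that the edge is absent.  An orbigraph
   on n vertices is given by its adjacency matrix A : 'M[nat]_n, which coerces
   to a weight function on 'I_n. *)

Definition orbigraph (k n : nat) (A : 'M[nat]_n) : Prop :=
  (forall i, \sum_j A i j = k) /\
  (forall i j, (0 < A i j) = (0 < A j i)).

Definition underlying (n : nat) (A : 'M[nat]_n) : rel 'I_n :=
  [rel i j | (0 < A i j) || (0 < A j i)].

Definition connected_orbigraph (n : nat) (A : 'M[nat]_n) : Prop :=
  0 < n /\ forall i j, connect (underlying A) i j.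

Definition wiso (V W : Type) (w1 : V -> V -> nat) (w2 : W -> W -> nat) : Prop :=
  exists f : V -> W, bijective f /\ forall u v, w2 (f u) (f v) = w1 u v.

Definition equitable (V : finType) (w : V -> V -> nat) (P : {set {set V}}) :
    Prop :=
  partition P [set: V] /\
  forall X Y : {set V}, X \in P -> Y \in P ->
  forall u u', u \in X -> u' \in X ->
    \sum_(v in Y) w u v = \sum_(v in Y) w u' v.

(* The blocks of a partition are nonempty, so the default 0 is never used;
   the choice of u is irrelevant when P is equitable. *)
Definition quotient_weight (V : finType) (w : V -> V -> nat)
    (P : {set {set V}}) (X Y : {Z : {set V} | Z \in P}) : nat :=
  if [pick u in val X] is Some u then \sum_(v in val Y) w u v else 0.

Definition simple_graph (V : finType) (e : rel V) : Prop :=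
  symmetric e /\ irreflexive e.

Definition regular_graph (k : nat) (V : finType) (e : rel V) : Prop :=
  forall u, #|[set v | e u v]| = k.

Definition graph_weight (V : finType) (e : rel V) (u v : V) : nat := e u v.

Definition good (k n : nat) (A : 'M[nat]_n) : Prop :=
  exists (V : finType) (e : rel V) (P : {set {set V}}),
    [/\ simple_graph e, regular_graph k e, equitable (graph_weight e) P
      & wiso A (@quotient_weight V (graph_weight e) P)].

Definition bad (k n : nat) (A : 'M[nat]_n) : Prop := ~ good k A.

(* Algebraic multiplicity of z as an eigenvalue of A; since the entries are
   integers, all complex eigenvalues lie in algC. *)
Definition eigenvalue_mult (n : nat) (A : 'M[nat]_n) (z : algC) : nat :=
  mup z (char_poly (map_mx (fun m : nat => m%:R%R : algC) A)).

Definition same_spectrum (m n : nat) (A : 'M[nat]_m) (B : 'M[nat]_n) : Prop :=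
  forall z : algC, eigenvalue_mult A z = eigenvalue_mult B z.

(* Main.v *)
(* Double counting the edges between two blocks X and Y of an equitable
   partition gives |X| w(X,Y) = |Y| w(Y,X), so the product of the weights of a
   good orbigraph around a closed walk does not depend on the orientation.  For
   k = 3 the quotient of K_4 by a partition into blocks of sizes 1, 1, 2 has
   characteristic polynomial (X - 3)(X + 1)^2.  A 3-orbigraph on a triangle with
   the same characteristic polynomial has weight products 1 and 4 around its
   two oriented triangles, hence is bad. *)
Require Import Defs.
From mathcomp Require Import all_boot all_order all_algebra all_field.
From mathcomp Require Import ring.

Set Implicit Arguments.
Unset Strict Implicit.
Unset Printing Implicit Defensive.

Import GRing.Theory.

Section EquitablePartition.

Variables (V : finType) (w : V -> V -> nat) (P : {set {set V}}).
Hypothesis Peq : equitable w P.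

Lemma quotient_weightE (X Y : {Z : {set V} | Z \in P}) u :
  u \in val X -> quotient_weight w X Y = \sum_(v in val Y) w u v.
Proof.
move=> uX; rewrite /quotient_weight; case: pickP => [u' u'X|/(_ u)].
  exact: (Peq.2 _ _ (valP X) (valP Y)).
by rewrite uX.
Qed.

Lemma card_quotient_weight (X Y : {Z : {set V} | Z \in P}) :
  #|val X| * quotient_weight w X Y = \sum_(u in val X) \sum_(v in val Y) w u v.
Proof.
rewrite -sum_nat_const; apply: eq_bigr => u uX.
by rewrite (quotient_weightE Y uX).
Qed.

Lemma block_card_gt0 (X : {Z : {set V} | Z \in P}) : 0 < #|val X|.
Proof.
case/and3P: Peq.1 => _ _ nP0; rewrite card_gt0.
by apply: contraNneq nP0 => <-; exact: valP.
Qed.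

End EquitablePartition.

Lemma good_symmetrizable k n (A : 'M[nat]_n) : good k A ->
  exists s : 'I_n -> nat,
    (forall i, 0 < s i) /\ (forall i j, s i * A i j = s j * A j i).
Proof.
case=> V [e [P [[eS _] _ Peq [f [_ fA]]]]].
(* The symmetrizing vector consists of the block sizes; once the sums are exchanged, only the
   symmetry of [e] is left to use. *)
exists (fun i => #|val (f i)|); split=> [i|i j].
  exact: block_card_gt0 Peq _.
rewrite -!fA !(card_quotient_weight Peq) exchange_big /=.
by do 2!apply: eq_bigr => ? _; rewrite /graph_weight eS.
Qed.

(** After scaling by the positive number [s i * s j * s l], each factor [s] pairs with one edge of
    the triangle and turns it around. *)
Lemma good_triangle k n (A : 'M[nat]_n) (i j l : 'I_n) : good k A ->
  A i j * A j l * A l i = A i l * A l j * A j i.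
Proof.
case/good_symmetrizable=> s [s_gt0 sA].
have s3_gt0 : 0 < s i * s j * s l by rewrite !muln_gt0 !s_gt0.
apply/eqP; rewrite -(eqn_pmul2l s3_gt0); apply/eqP.
transitivity ((s i * A i j) * (s j * A j l) * (s l * A l i)); first by ring.
by rewrite (sA i j) (sA j l) (sA l i); ring.
Qed.

(** The blocks are the fibers of [f]. The section [g] puts a vertex in every fiber, so fibers over
    distinct indices are nonempty and distinct, and the quotient is indexed by ['I_n] itself. *)
Lemma good_of_fibers k n (A : 'M[nat]_n) (V : finType) (e : rel V)
    (f : V -> 'I_n) (g : 'I_n -> V) :
  simple_graph e -> regular_graph k e -> cancel g f ->
  (forall u j, \sum_(v | f v == j) graph_weight e u v = A (f u) j) ->
  good k A.
Proof.
move=> eS eR gK fA; pose F j := f @^-1: [set j].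
have memF u j : (u \in F j) = (f u == j) by rewrite !inE.
have sumF u j : \sum_(v in F j) graph_weight e u v = A (f u) j.
  by rewrite -fA; apply: eq_bigl => v; rewrite memF.
have F_inj : injective F.
  by move=> i j /setP/(_ (g i)); rewrite !memF gK eqxx => /esym/eqP.
pose P := [set F j | j in [set: 'I_n]].
have FP j : F j \in P by apply: imset_f.
(* A sigma type rather than an existential: its witness defines the inverse of [h] below. *)
have PF X : X \in P -> {j | F j = X}.
  move=> XP; have: [exists j, F j == X].
    by case/imsetP: XP => j _ ->; apply/existsP; exists j.
  by move/existsP/sigW => [j /eqP]; exists j.
have Peq : equitable (graph_weight e) P.
  split=> [|X Y /PF[i <-] /PF[j <-] u u']; last first.
    by rewrite !memF !sumF => /eqP-> /eqP->.
  apply/and3P; split.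
  - apply/eqP/setP=> u; rewrite inE; apply/bigcupP.
    by exists (F (f u)); rewrite ?memF.
  - apply/trivIsetP=> X Y /PF[i <-] /PF[j <-] neq_ij.
    rewrite -setI_eq0; apply: contraNT neq_ij => /set0Pn[u].
    by rewrite inE !memF => /andP[/eqP-> /eqP->].
  - apply/negP=> /PF[j /setP/(_ (g j))].
    by rewrite memF gK eqxx inE.
exists V, e, P; split=> //.
pose h j : {Z : {set V} | Z \in P} := exist _ (F j) (FP j).
exists h; split=> [|i j].
  exists (fun X => sval (PF (val X) (valP X))) => [j|X].
    by apply: F_inj; case: (PF _ _).
  by apply: val_inj => /=; case: (PF _ _).
have giF : g i \in val (h i) by rewrite /= memF gK.
by rewrite (quotient_weightE Peq _ giF) /= sumF gK.
Qed.

Definition mx_of_rows (n : nat) (s : seq (seq nat)) : 'M[nat]_n :=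
  \matrix_(i, j) nth 0 (nth [::] s i) j.

Definition good_example := mx_of_rows 3 [:: [:: 0; 1; 2]; [:: 1; 0; 2]; [:: 1; 1; 1]].
Definition bad_example := mx_of_rows 3 [:: [:: 0; 1; 2]; [:: 2; 0; 1]; [:: 1; 1; 1]].

Ltac ord3 i := case: i => [[|[|[|i]]] ?] //.

Lemma orbigraph_good_example : orbigraph 3 good_example.
Proof.
split=> [i|i j]; last by rewrite !mxE; ord3 i; ord3 j.
by rewrite !big_ord_recr big_ord0 /= !mxE; ord3 i.
Qed.

Lemma orbigraph_bad_example : orbigraph 3 bad_example.
Proof.
split=> [i|i j]; last by rewrite !mxE; ord3 i; ord3 j.
by rewrite !big_ord_recr big_ord0 /= !mxE; ord3 i.
Qed.

Lemma complete_connected n (A : 'M[nat]_n.+1) :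
  (forall i j, i != j -> 0 < A i j) -> connected_orbigraph A.
Proof.
move=> A_gt0; split=> // i j.
have [->|/A_gt0 Aij] := eqVneq i j; first exact: connect0.
by apply: connect1; apply/orP; left.
Qed.

Lemma connected_good_example : connected_orbigraph good_example.
Proof. by apply: complete_connected => i j; rewrite mxE; ord3 i; ord3 j. Qed.

Lemma connected_bad_example : connected_orbigraph bad_example.
Proof. by apply: complete_connected => i j; rewrite mxE; ord3 i; ord3 j. Qed.

Lemma good_good_example : good 3 good_example.
Proof.
(* In the complete graph on 0, 1, 2, 3 the fibers of [f] are {0}, {1} and {2, 3}; the inclusion of
   ['I_3] in ['I_4] is a section. *)
pose f (u : 'I_4) : 'I_3 := inord (minn u 2).
have fE (u : 'I_4) (j : 'I_3) : (f u == j) = (minn u 2 == j).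
  by rewrite -val_eqE /= inordK // ltnS geq_minr.
apply: (@good_of_fibers 3 3 _ 'I_4 (fun u v => u != v) f (widen_ord (leqnSn 3))).
- by split=> [u v|u]; rewrite ?eqxx // eq_sym.
- move=> u; transitivity #|~: [set u]|; last by rewrite cardsC1 card_ord.
  by apply: eq_card => v; rewrite !inE eq_sym.
- by move=> i; apply/eqP; rewrite fE; ord3 i.
- move=> u j; rewrite (eq_bigl _ _ (fun v => fE v j)) big_mkcond /=.
  rewrite !big_ord_recr big_ord0 /= !mxE /f /graph_weight -!val_eqE /=.
  rewrite inordK ?ltnS ?geq_minr //.
  by case: u => [[|[|[|[|u]]]] ?] //; ord3 j.
Qed.

Lemma bad_bad_example : bad 3 bad_example.
Proof.
(* The two products are 1 * 1 * 1 and 2 * 1 * 2. *)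
move/(good_triangle (inord 0) (inord 1) (inord 2)).
by rewrite !mxE !inordK.
Qed.

Section Spectrum.

Local Open Scope ring_scope.

(** Indices are written as [inord] of numerals so that, for an explicit matrix, [inordK] evaluates
    every entry. *)
Lemma det_mx33 (R : comNzRingType) (M : 'M[R]_3) :
  let m i j := M (inord i) (inord j) in
  \det M = m 0%N 0%N * (m 1%N 1%N * m 2%N 2%N - m 1%N 2%N * m 2%N 1%N)
         - m 0%N 1%N * (m 1%N 0%N * m 2%N 2%N - m 1%N 2%N * m 2%N 0%N)
         + m 0%N 2%N * (m 1%N 0%N * m 2%N 1%N - m 1%N 1%N * m 2%N 0%N).
Proof.
move=> m; have mE i j : M i j = m i j by rewrite /m !inord_val.
rewrite (expand_det_row _ ord0) !big_ord_recl big_ord0 /cofactor.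
rewrite !(expand_det_row _ (ord0 : 'I_2)) !big_ord_recl !big_ord0 /cofactor.
rewrite !det_mx11 !mxE !mE /=.
by rewrite /bump /=; ring.
Qed.

(** Both matrices have trace 1, principal 2 by 2 minors summing to -5 and determinant 3, so both
    polynomials are X^3 - X^2 - 5X - 3 over any commutative ring. *)
Lemma char_poly_examples (R : comNzRingType) :
  char_poly (map_mx (fun m : nat => m%:R : R) good_example)
  = char_poly (map_mx (fun m : nat => m%:R : R) bad_example).
Proof.
rewrite /char_poly !det_mx33 !mxE -!val_eqE /= !inordK //=.
rewrite !(mulr0n, mulr1n, polyC0, polyC1, polyCMn); ring.
Qed.

End Spectrum.

Theorem theorem6p4 :
  exists (k m n : nat) (A : 'M[nat]_m) (B : 'M[nat]_n),
    [/\ orbigraph k A /\ connected_orbigraph A,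
        orbigraph k B /\ connected_orbigraph B,
        good k A,
        bad k B
      & same_spectrum A B].
Proof.
exists 3, 3, 3, good_example, bad_example; split.
- by split; [exact: orbigraph_good_example | exact: connected_good_example].
- by split; [exact: orbigraph_bad_example | exact: connected_bad_example].
- exact: good_good_example.
- exact: bad_bad_example.
- by move=> z; rewrite /eigenvalue_mult char_poly_examples.
Qed.
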